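(* Let $A\in\mathbb{C}^{m\times n}$, $B\in\mathbb{C}^{m}_{\mathrm H}$ and $T\in\mathbb{C}^{p\times m}$, and assume that $AXA^*=B$ has a Hermitian solution. Put $$\mathcal{S}=\{X\in\mathbb{C}^{n}_{\mathrm H}\mid AXA^*=B\},\qquad \mathcal{T}=\{Y\in\mathbb{C}^{n}_{\mathrm H}\mid TAYA^*T^*=TBT^*\}.$$ Then: (a) There exist $X\in\mathcal{S}$ and $Y\in\mathcal{T}$ such that $X\succ Y$ (respectively $X\prec Y$) if and only if $TA=0$. Hence, if the equation $TAYA^*T^*=TBT^*$ is not null (i.e. $TA\neq0$), there do not exist $X\in\mathcal{S}$ and $Y\in\mathcal{T}$ such that $X\succ Y$ (respectively $X\prec Y$). (b) There always exist $X\in\mathcal{S}$ and $Y\in\mathcal{T}$ such that $X\succcurlyeq Y$ (respectively $X\preccurlyeq Y$).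
   Context: $\mathbb{C}^{k}_{\mathrm H}$ is the set of $k\times k$ complex Hermitian matrices ($m,n,p\ge1$). $A^*$ denotes the conjugate transpose of $A$. For Hermitian $H,K$ of the same size, $H\succcurlyeq K$ ($H\succ K$) means $H-K$ is Hermitian positive semidefinite (positive definite); $H\preccurlyeq K$, $H\prec K$ mean $K\succcurlyeq H$, $K\succ H$. *)

(* Defs.v *)
From mathcomp Require Import all_boot all_order all_algebra.
From mathcomp Require Import classical_sets reals complex.

Set Implicit Arguments.
Unset Strict Implicit.
Unset Printing Implicit Defensive.

Import Order.TTheory GRing.Theory Num.Theory.
Local Open Scope classical_set_scope.
Local Open Scope ring_scope.
Local Open Scope sesquilinear_scope.

(* In a numClosedFieldType, [0 <= z] and [0 < z] entail that [z] is real. *)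

Definition psdmx (C : numClosedFieldType) (n : nat) (H : 'M[C]_n) : Prop :=
  H \is hermsymmx /\ forall v : 'cV[C]_n, 0 <= (v ^t* *m H *m v) 0 0.

Definition pdmx (C : numClosedFieldType) (n : nat) (H : 'M[C]_n) : Prop :=
  H \is hermsymmx /\
  forall v : 'cV[C]_n, v != 0 -> 0 < (v ^t* *m H *m v) 0 0.

Definition loewner_ge (C : numClosedFieldType) (n : nat) (H K : 'M[C]_n) :
  Prop := psdmx (H - K).

Definition loewner_gt (C : numClosedFieldType) (n : nat) (H K : 'M[C]_n) :
  Prop := pdmx (H - K).

Definition loewner_le (C : numClosedFieldType) (n : nat) (H K : 'M[C]_n) :
  Prop := loewner_ge K H.

Definition loewner_lt (C : numClosedFieldType) (n : nat) (H K : 'M[C]_n) :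
  Prop := loewner_gt K H.

Definition herm_solutions (C : numClosedFieldType) (m n : nat)
    (A : 'M[C]_(m, n)) (B : 'M[C]_m) : set 'M[C]_n :=
  [set X | X \is hermsymmx /\ A *m X *m A ^t* = B].

Definition herm_transformed_solutions (C : numClosedFieldType) (m n p : nat)
    (A : 'M[C]_(m, n)) (B : 'M[C]_m) (T : 'M[C]_(p, m)) : set 'M[C]_n :=
  [set Y | Y \is hermsymmx /\
           T *m A *m Y *m A ^t* *m T ^t* = T *m B *m T ^t*].

(* Main.v *)
Require Import Defs.
From mathcomp Require Import all_boot all_order all_algebra.
From mathcomp Require Import classical_sets reals complex.

Import Order.TTheory GRing.Theory Num.Theory.
Local Open Scope ring_scope.

(** Every [X] with [A X A^* = B] also satisfies the equation multiplied by [T]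
    on the left and by [T^*] on the right, so the first solution set lies in
    the second; taking [Y = X] settles the weak inequalities.

    For the strict ones, [D = X - Y] satisfies [(T A) D (T A)^* = 0] for all
    [X] and [Y] in the two sets. If [D] or [- D] is positive definite, then each
    column of [(T A)^*] is a vector on which a definite form vanishes, so
    [T A = 0] ([pdmx_congr_eq0]). Conversely, if [T A = 0], the transformed
    equation constrains [Y] no more: solvability of [A X A^* = B] makes its
    right-hand side [(T A) X (T A)^*] vanish too. So [Y] may be any Hermitian
    matrix, for instance [X - 1] or [X + 1] ([loewner_gt_solutions],
    [loewner_lt_solutions]). *)

Section HermitianSolutions.
Set Implicit Arguments.
Unset Strict Implicit.
Local Open Scope sesquilinear_scope.
Variable C : numClosedFieldType.

Lemma trmxC_mul m n p (M : 'M[C]_(m, n)) (N : 'M[C]_(n, p)) :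
  (M *m N) ^t* = N ^t* *m M ^t*.
Proof. by rewrite trmx_mul map_mxM. Qed.

Lemma hermsymmxE n (H : 'M[C]_n) : (H \is hermsymmx) = (H == H ^t*).
Proof. by rewrite is_hermitianmxE expr0 scale1r. Qed.

Lemma hermsymmxB n (H K : 'M[C]_n) :
  H \is hermsymmx -> K \is hermsymmx -> H - K \is hermsymmx.
Proof.
by rewrite !hermsymmxE linearB /= map_mxB => /eqP <- /eqP <-.
Qed.

Lemma hermsymmxD n (H K : 'M[C]_n) :
  H \is hermsymmx -> K \is hermsymmx -> H + K \is hermsymmx.
Proof.
by rewrite !hermsymmxE linearD /= map_mxD => /eqP <- /eqP <-.
Qed.

Lemma pdmx1 n : pdmx (1%:M : 'M[C]_n).
Proof.
split; first exact: hermitian1mx_subproof.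
move=> v v_neq0; rewrite mulmx1 mxE.
have term_ge0 (i : 'I_n) : 0 <= (v ^t*) 0 i * v i 0.
  by rewrite !mxE mulrC mul_conjC_ge0.
rewrite lt_def sumr_ge0 ?andbT; last by move=> i _; exact: term_ge0.
apply: contra v_neq0; rewrite psumr_eq0 => [/allP sum0|i _]; last exact: term_ge0.
apply/eqP/matrixP => i j; rewrite (ord1 j) mxE; apply/eqP.
by have := sum0 i (mem_index_enum i); rewrite !mxE mulrC mul_conjC_eq0.
Qed.

Lemma psdmx0 n : psdmx (0 : 'M[C]_n).
Proof.
split=> [|v]; last by rewrite mulmx0 mul0mx mxE.
by rewrite hermsymmxE trmx0 map_mx0.
Qed.

(** The diagonal entries of [M H M^*] are the values of the form [H] at the
    columns of [M^*]; a definite form vanishes at the zero vector only. *)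
Lemma pdmx_congr_eq0 n p (H : 'M[C]_n) (M : 'M[C]_(p, n)) :
  pdmx H -> M *m H *m M ^t* = 0 -> M = 0.
Proof.
move=> [_ H_pos] MHM0; apply/row_matrixP => i; rewrite row0.
have val0 : (row i M) ^t* ^t* *m H *m (row i M) ^t* = 0.
  rewrite trmxCK rowE trmxC_mul.
  rewrite (_ : _ *m _ = delta_mx 0 i *m (M *m H *m M ^t*) *m (delta_mx 0 i) ^t*).
    by rewrite MHM0 mulmx0 mul0mx.
  by rewrite !mulmxA.
have [v0|/H_pos] := eqVneq ((row i M) ^t*) 0; last by rewrite val0 mxE ltxx.
by rewrite -[row i M]trmxCK v0 trmx0 map_mx0.
Qed.

Lemma herm_solutions_transformed m n p (A : 'M[C]_(m, n)) (B : 'M[C]_m)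
    (T : 'M[C]_(p, m)) (X : 'M[C]_n) :
  herm_solutions A B X -> herm_transformed_solutions A B T X.
Proof. by case=> X_herm <-; split; rewrite ?mulmxA. Qed.

Lemma sub_transformed_solutions m n p (A : 'M[C]_(m, n)) (B : 'M[C]_m)
    (T : 'M[C]_(p, m)) (X Y : 'M[C]_n) :
  herm_transformed_solutions A B T X -> herm_transformed_solutions A B T Y ->
  T *m A *m (X - Y) *m (T *m A) ^t* = 0.
Proof.
move=> [_ eqX] [_ eqY].
by rewrite trmxC_mul mulmxBr mulmxBl !mulmxA eqX eqY subrr.
Qed.

(** When [T A = 0], both sides of the transformed equation vanish, the right
    one because [T B T^* = (T A) X (T A)^*] for a solution [X]. *)
Lemma transformed_solutions_null m n p (A : 'M[C]_(m, n)) (B : 'M[C]_m)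
    (T : 'M[C]_(p, m)) (X Y : 'M[C]_n) :
  herm_solutions A B X -> T *m A = 0 -> Y \is hermsymmx ->
  herm_transformed_solutions A B T Y.
Proof.
by move=> [_ <-] TA0 Y_herm; split=> //; rewrite !mulmxA TA0 !mul0mx.
Qed.

Lemma loewner_gt_solutions m n p (A : 'M[C]_(m, n)) (B : 'M[C]_m)
    (T : 'M[C]_(p, m)) :
  (exists X, herm_solutions A B X) ->
  (exists X Y : 'M[C]_n, [/\ herm_solutions A B X,
     herm_transformed_solutions A B T Y & loewner_gt X Y]) <-> T *m A = 0.
Proof.
move=> [X0 X0_sol]; split=> [[X [Y [X_sol Y_sol]]]|TA0].
  move/pdmx_congr_eq0; apply; apply: sub_transformed_solutions Y_sol.
  exact: herm_solutions_transformed X_sol.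
exists X0, (X0 - 1%:M); split=> //; last first.
  by rewrite /loewner_gt opprB addrC subrK; exact: pdmx1.
apply: (transformed_solutions_null X0_sol TA0).
by apply: hermsymmxB; [case: X0_sol | exact: hermitian1mx_subproof].
Qed.

Lemma loewner_lt_solutions m n p (A : 'M[C]_(m, n)) (B : 'M[C]_m)
    (T : 'M[C]_(p, m)) :
  (exists X, herm_solutions A B X) ->
  (exists X Y : 'M[C]_n, [/\ herm_solutions A B X,
     herm_transformed_solutions A B T Y & loewner_lt X Y]) <-> T *m A = 0.
Proof.
move=> [X0 X0_sol]; split=> [[X [Y [X_sol Y_sol]]]|TA0].
  move/pdmx_congr_eq0; apply; apply: (sub_transformed_solutions Y_sol).
  exact: herm_solutions_transformed X_sol.
exists X0, (X0 + 1%:M); split=> //; last first.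
  by rewrite /loewner_lt /loewner_gt addrC addKr; exact: pdmx1.
apply: (transformed_solutions_null X0_sol TA0).
by apply: hermsymmxD; [case: X0_sol | exact: hermitian1mx_subproof].
Qed.

End HermitianSolutions.

Theorem theorem4p2 (R : realType) (m n p : nat)
    (m_gt0 : (0 < m)%N) (n_gt0 : (0 < n)%N) (p_gt0 : (0 < p)%N)
    (A : 'M[R[i]]_(m, n)) (B : 'M[R[i]]_m) (T : 'M[R[i]]_(p, m))
    (B_herm : B \is hermsymmx)
    (solvable : exists X : 'M[R[i]]_n, herm_solutions A B X) :
  let S := herm_solutions A B in
  let T' := herm_transformed_solutions A B T in
  (* (a) *)
  ((((exists X Y : 'M[R[i]]_n, [/\ S X, T' Y & loewner_gt X Y]) <->
       T *m A = 0) /\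
    ((exists X Y : 'M[R[i]]_n, [/\ S X, T' Y & loewner_lt X Y]) <->
       T *m A = 0)) /\
   (T *m A <> 0 ->
      ~ (exists X Y : 'M[R[i]]_n, [/\ S X, T' Y & loewner_gt X Y]) /\
      ~ (exists X Y : 'M[R[i]]_n, [/\ S X, T' Y & loewner_lt X Y]))) /\
  (* (b) *)
  ((exists X Y : 'M[R[i]]_n, [/\ S X, T' Y & loewner_ge X Y]) /\
   (exists X Y : 'M[R[i]]_n, [/\ S X, T' Y & loewner_le X Y])).
Proof.
have gt_iff := loewner_gt_solutions T solvable.
have lt_iff := loewner_lt_solutions T solvable.
case: solvable => X0 X0_sol S T'.
have X0_trans : T' X0 := herm_solutions_transformed T X0_sol.
split; first by split=> // TA_neq0; split=> [/gt_iff|/lt_iff].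
by split; exists X0, X0; split=> //;
  rewrite /loewner_le /loewner_ge subrr; exact: psdmx0.
Qed.
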